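(* Let $l\in\mathbb{Z}_{\ge 0}$ and $r\in\mathbb{Z}$. Let $c\in\mathbb{R}$ satisfy either $c<r-l$, or $-c\in\mathbb{Z}_{\ge0}$ and $c\le r-l$. Then for arbitrary $a,b\in\mathbb{R}$ (such that both sides are well defined in the sense specified in the context) the following identity holds: $$ {}_{3}F_2\!\left(\begin{array}{c} a,\; b-r,\; c \\ {a-l},\; b+1\end{array}\Big|\,1\right) =\frac{(-1)^l\,\Gamma(1-c)\,\Gamma(1+b)\,(a-c-l)_r\,(1-b)_r}{\Gamma(1+b-c)\,(1-a)_l\,(a-b)_{r-l}\,r!}\; {}_{3}F_2\!\left(\begin{array}{c} -r,\; 1-a,\; c-b \\ {1-b},\; 1-a+c+l-r\end{array}\Big|\,1\right). $$ In particular, both sides are zero if $r<0$.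
   Context: The generalized hypergeometric series is ${}_3F_2\!\left(\begin{array}{c} a_1,a_2,a_3 \\ {b_1},b_2\end{array}\Big|\,x\right)=\sum_{k\ge0}\frac{(a_1)_k(a_2)_k(a_3)_k}{(b_1)_k(b_2)_k}\frac{x^k}{k!}$. The Pochhammer symbol is $(z)_k=\Gamma(z+k)/\Gamma(z)$ for all integers $k$: for $k\ge0$ it is $z(z+1)\cdots(z+k-1)$ (with $(z)_0=1$), and for $k<0$ it is $(z)_k=(-1)^k/(1-z)_{-k}$. Conventions: if $-c\in\mathbb{Z}_{\ge0}$, the series on the left is the finite sum over $0\le k\le -c$; if $r\ge 0$, the series on the right is the finite sum over $0\le k\le r$; if $r<0$, then $1/r!=0$ and the right-hand side is read as $0$; $1/\Gamma$ is taken to be $0$ at the poles of $\Gamma$. ''Well defined'' means: no denominator vanishes in any term of the series (where the left series is summed over $0\le k\le -c$ if $-c\in\mathbb{Z}_{\ge0}$ and over all $k\ge0$ otherwise, and the right series is summed over $0\le k\le r$ if $r\ge0$), $\Gamma(1-c)$ and $\Gamma(1+b)$ are not evaluated at poles, all Pochhammer symbols appearing in the prefactor are finite, and those in its denominator are nonzero. *)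

(* Defs.v *)
From HB Require Import structures.
From mathcomp Require Export all_boot all_order all_algebra.
From mathcomp Require Export all_classical all_reals all_analysis.
Set Implicit Arguments.
Unset Strict Implicit.
Unset Printing Implicit Defensive.
Export Order.TTheory GRing.Theory Num.Theory numFieldNormedType.Exports.
Local Open Scope classical_set_scope.
Local Open Scope ring_scope.

Definition rising {R : realType} (z : R) (k : nat) : R :=
  \prod_(i < k) (z + i%:R).

(* For k = Negz n = - n.+1 this is (-1)^k / (1 - z)_(-k); it is only meaningful
   when [poch_finite z k] holds. *)
Definition poch {R : realType} (z : R) (k : int) : R :=
  match k with
  | Posz n => rising z n
  | Negz n => (-1) ^+ n.+1 / rising (1 - z) n.+1
  end.

Definition poch_finite {R : realType} (z : R) (k : int) : Prop :=
  match k with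
  | Posz _ => True
  | Negz n => rising (1 - z) n.+1 != 0
  end.

Definition Gamma_pole {R : realType} (x : R) : bool := - x \is a Num.nat.

(* Euler's limit formula, Gamma(x) = lim_n n! n^(x-1) / (x)_n, which converges
   at every real x that is not a pole. *)
Definition Gamma {R : realType} (x : R) : R :=
  limn (fun n : nat => n`!%:R * n%:R `^ (x - 1) / rising x n).

Definition invGamma {R : realType} (x : R) : R :=
  if Gamma_pole x then 0 else (Gamma x)^-1.

Definition invfact {R : realType} (r : int) : R :=
  match r with
  | Posz n => (n`!%:R)^-1
  | Negz _ => 0
  end.

Definition hyp3F2_term {R : realType} (a1 a2 a3 b1 b2 x : R) (k : nat) : R :=
  rising a1 k * rising a2 k * rising a3 k / (rising b1 k * rising b2 k)
  * (x ^+ k / k`!%:R).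

(* The number of terms is explicit, because a series that terminates by
   convention may have vanishing denominators beyond its last term: [Some n]
   stands for the sum over k < n, [None] for the sum over all k. *)
Definition hyp3F2 {R : realType} (N : option nat) (a1 a2 a3 b1 b2 x : R) : R :=
  match N with
  | Some n => \sum_(k < n) hyp3F2_term a1 a2 a3 b1 b2 x k
  | None => limn (series (hyp3F2_term a1 a2 a3 b1 b2 x))
  end.

Definition hyp3F2_converges {R : realType} (N : option nat)
    (a1 a2 a3 b1 b2 x : R) : Prop :=
  match N with
  | Some _ => True
  | None => cvgn (series (hyp3F2_term a1 a2 a3 b1 b2 x))
  end.

Definition hyp3F2_denoms_neq0 {R : realType} (N : option nat) (b1 b2 : R) :
    Prop :=
  forall k : nat, (if N is Some n then (k < n)%N else true) ->
    rising b1 k != 0 /\ rising b2 k != 0.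

(* 0 <= k <= -c if -c is a natural number, all k otherwise *)
Definition lhs_terms {R : realType} (c : R) : option nat :=
  if - c \is a Num.nat then Some (Num.truncn (- c)).+1 else None.

(* 0 <= k <= r, no term at all if r < 0 *)
Definition rhs_terms (r : int) : option nat :=
  match r with
  | Posz n => Some n.+1
  | Negz _ => Some 0%N
  end.

(* Main.v *)
(* Writing (a)_k / (a-l)_k = (a-l+k)_l / (a-l)_l and expanding (a-l+k)_l by
   Vandermonde in the basis (b-r+k)_j, 0 <= j <= l, turns the left-hand side into
   a combination of the Gauss series 2F1(c, b-r+j; b+1; 1), all convergent because
   c < r-l+1.  Gauss's theorem makes the j-th one proportional to 1/Gamma(r-j+1),
   so the terms with j > r vanish, and all of them do if r < 0.  The remaining
   finite identity follows by expanding (a-c-l)_(r-k) on the right by Vandermonde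
   in (-l)_j and summing over k with the Pfaff-Saalschuetz formula.

   Gauss's theorem itself is proved by the contiguous relation
   G (G-A-B) F(G) = (G-A) (G-B) F(G+1), where F(G) = 2F1(A, B; G; 1), together
   with F(G+m) --> 1 and Euler's limit formula for the resulting product. *)
Require Import Defs.
From mathcomp Require Import ring lra zify.
Set Implicit Arguments.
Unset Strict Implicit.
Unset Printing Implicit Defensive.
Local Open Scope classical_set_scope.
Local Open Scope ring_scope.

(** * Rising factorials and terminating sums *)

Lemma rising0 (R : realType) (z : R) : rising z 0 = 1.
Proof. by rewrite /rising big_ord0. Qed.

Lemma risingS (R : realType) (z : R) k :
  rising z k.+1 = rising z k * (z + k%:R).
Proof. by rewrite /rising big_ord_recr. Qed.

Lemma risingD (R : realType) (z : R) m n :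
  rising z (m + n) = rising z m * rising (z + m%:R) n.
Proof.
elim: n => [|n IH]; first by rewrite addn0 rising0 mulr1.
by rewrite addnS !risingS IH natrD !addrA mulrA.
Qed.

Lemma risingSl (R : realType) (z : R) k :
  rising z k.+1 = z * rising (z + 1) k.
Proof. by rewrite -add1n risingD risingS rising0 mul1r addr0. Qed.

Lemma rising_opp (R : realType) (z : R) n :
  rising (- z) n = (-1) ^+ n * rising (z - n%:R + 1) n.
Proof.
elim: n z => [|n IH] z; first by rewrite !rising0 mulr1.
rewrite risingS IH exprS risingSl -natr1.
have -> : z - (n%:R + 1) + 1 + 1 = z - n%:R + 1 by ring.
ring.
Qed.

Lemma rising1 (R : realType) n : rising (1 : R) n = n`!%:R.
Proof.
elim: n => [|n IH]; first by rewrite rising0.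
by rewrite risingS IH factS natrM mulrC nat1r.
Qed.

Lemma rising_opp_nat (R : realType) l j :
  rising (- l%:R : R) j = (-1) ^+ j * ('C(l, j) * j`!)%:R.
Proof.
rewrite bin_ffact; elim: j => [|j IH]; first by rewrite rising0 ffactn0 mulr1.
rewrite risingS IH ffactnSr exprS natrM.
have [lj|jl] := ltnP l j; first by rewrite ffact_small// !(mul0r, mulr0).
rewrite natrB//; ring.
Qed.

Lemma rising_vandermonde (R : realType) (u v : R) n :
  rising (u + v) n =
  \sum_(j < n.+1) 'C(n, j)%:R * rising u j * rising v (n - j).
Proof.
elim: n => [|n IH]; first by rewrite big_ord1 !rising0 !mulr1.
(* Padding with the zero term j = n + 1 and peeling off j = 0 gives the half of Pascal's rule that
   carries ['C(n, j.+1)]. *)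
have stepl : \sum_(j < n.+1) 'C(n, j)%:R * rising u j * rising v (n.+1 - j) =
   rising v n.+1 +
   \sum_(j < n.+1) 'C(n, j.+1)%:R * rising u j.+1 * rising v (n - j).
  transitivity (\sum_(j < n.+2) 'C(n, j)%:R * rising u j * rising v (n.+1 - j)).
    by rewrite [RHS]big_ord_recr /= bin_small// !mul0r addr0.
  by rewrite big_ord_recl /= bin0 rising0 !mul1r.
rewrite big_ord_recl /= bin0 rising0 !mul1r subn0.
under eq_bigr do rewrite /= binS natrD -mulrA mulrDl !mulrA subSS.
rewrite big_split /= addrA -stepl risingS IH mulr_suml -big_split /=.
apply: eq_bigr => -[j] /=; rewrite ltnS => jn _.
rewrite subSn// !risingS natrB//; ring.
Qed.

Lemma sum_ord_trim (R : realType) (g : nat -> R) m N : (m <= N)%N ->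
  (forall j, (m <= j)%N -> g j = 0) -> \sum_(j < N) g j = \sum_(j < m) g j.
Proof.
move=> mN g0; rewrite [RHS](big_ord_widen _ g mN) [RHS]big_mkcond.
by apply: eq_bigr => j _; case: ltnP => // /g0.
Qed.

Lemma sum_ord_support (R : realType) (g : nat -> R) m n :
  (forall j, (m <= j)%N -> g j = 0) -> (forall j, (n <= j)%N -> g j = 0) ->
  \sum_(j < m) g j = \sum_(j < n) g j.
Proof.
move=> gm gn; rewrite -(sum_ord_trim (leq_maxl m n) gm).
by rewrite (sum_ord_trim (leq_maxr m n) gn).
Qed.

(** For n = r - k, a range of j independent of k allows the double sum to be exchanged. *)
Lemma rising_vandermonde_wide (R : realType) (u v : R) n N : (n <= N)%N ->
  rising (u + v) n =
  \sum_(j < N.+1) 'C(n, j)%:R * rising u j * rising v (n - j).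
Proof.
move=> nN; rewrite rising_vandermonde; symmetry.
apply: (@sum_ord_trim _
  (fun j => 'C(n, j)%:R * rising u j * rising v (n - j))) => // j nj.
by rewrite bin_small// !mul0r.
Qed.

(** This is 3F2(-m, A, B; C, 1 + A + B - C - m; 1) with denominators cleared by (C)_m (C - A - B)_m,
    hence valid for all real parameters. *)
Lemma pfaff_saalschutz (R : realType) (A B C : R) m :
  \sum_(k < m.+1) 'C(m, k)%:R * rising A k * rising B k *
     rising (C + k%:R) (m - k) * rising (C - A - B) (m - k) =
  rising (C - A) m * rising (C - B) m.
Proof.
set D := C - A - B.
pose T m k := 'C(m, k)%:R * rising A k * rising B k *
     rising (C + k%:R) (m - k) * rising D (m - k).
rewrite (eq_bigr (fun k : 'I_m.+1 => T m k))//.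
elim: m => [|m IH]; first by rewrite big_ord1 /T /= !rising0 !mulr1.
(* Wilf-Zeilberger certificate for the recurrence in [m] *)
pose H k := if k is k'.+1 then
   - ('C(m, k')%:R * rising A k * rising B k *
      rising (C + k'%:R) (m - k') * rising D (m - k')) else 0.
have step k : (k < m.+1)%N ->
    T m.+1 k = (C - A + m%:R) * (C - B + m%:R) * T m k + (H k.+1 - H k).
  rewrite ltnS => km; rewrite /T /H subSn//.
  rewrite (@risingS _ D) (@risingS _ (C + _)).
  case: k km => [|k] km.
    rewrite !bin0 !rising0 !risingS !rising0 !subn0 /D; ring.
  have mk : (m - k = (m - k.+1).+1)%N by lia.
  rewrite mk (@risingS _ D (m - k.+1)) (@risingSl _ (C + k%:R)).
  have -> : C + k%:R + 1 = C + k.+1%:R by rewrite -natr1 addrA.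
  rewrite binS natrD.
  have key : ('C(m, k.+1)%:R * k.+1%:R = 'C(m, k)%:R * (m%:R - k%:R) :> R).
    rewrite -natrB 1?ltnW// -!natrM; congr (_%:R).
    by rewrite [LHS]mulnC mul_bin_left mulnC.
  rewrite !(@risingS _ A k.+1) !(@risingS _ B k.+1) natrB//.
  set x := rising (C + _) _; set y := rising D _.
  set p := rising A _; set q := rising B _.
  rewrite -!natr1 in key *.
  set b1 := 'C(m, k.+1)%:R in key *; set b0 := 'C(m, k)%:R in key *.
  apply/eqP; rewrite -subr_eq0; apply/eqP.
  (* The difference of the two sides is a multiple of the binomial relation [key]. *)
  transitivity (p * q * x * y * (b0 * (m%:R - k%:R) - b1 * (k%:R + 1)) *
    (C + m%:R - A - B - k%:R - 1)); last by rewrite key subrr mulr0 mul0r.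
  rewrite /D; ring.
rewrite big_ord_recr /=.
under eq_bigr => k _ do rewrite step//.
rewrite big_split /= -mulr_sumr IH.
rewrite -(big_mkord xpredT (fun k => H k.+1 - H k)) telescope_sumr//.
rewrite /T /H !subnn !binn !rising0 !(risingS (C - _)); ring.
Qed.

Lemma pfaff_saalschutz_wide (R : realType) (A B C : R) m N : (m <= N)%N ->
  \sum_(k < N.+1) 'C(m, k)%:R * rising A k * rising B k *
     rising (C + k%:R) (m - k) * rising (C - A - B) (m - k) =
  rising (C - A) m * rising (C - B) m.
Proof.
move=> mN; rewrite -pfaff_saalschutz.
apply: (@sum_ord_trim _ (fun k => 'C(m, k)%:R * rising A k * rising B k *
     rising (C + k%:R) (m - k) * rising (C - A - B) (m - k))) => // k nk.
by rewrite bin_small// !mul0r.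
Qed.

Lemma bin_invfact (R : realType) n k :
  'C(n, k)%:R / n`!%:R = if (k <= n)%N then (k`!%:R * (n - k)`!%:R)^-1 else 0 :> R.
Proof.
case: leqP => [kn|nk]; last by rewrite bin_small// mul0r.
have f0 i : i`!%:R != 0 :> R by rewrite pnatr_eq0 -lt0n fact_gt0.
have /(congr1 (fun i => i%:R : R)) := bin_fact kn.
rewrite !natrM => <-.
have b0 : 'C(n, k)%:R != 0 :> R by rewrite pnatr_eq0 -lt0n bin_gt0.
by field; rewrite !f0 b0.
Qed.

(* Expanding [rising (a - c - l) (r - k)] by Vandermonde in the rising
   factorials [rising (- l) j] turns each coefficient into a Pfaff-Saalschuetz
   sum. *)
Lemma terminating_transformation (R : realType) (a b c : R) l r :
  \sum_(k < r.+1) rising (1 - a) k * rising (c - b) k *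
     rising (a - c - l%:R) (r - k) * rising (1 - b + k%:R) (r - k) /
     (k`!%:R * (r - k)`!%:R) =
  \sum_(j < r.+1) 'C(l, j)%:R * rising (a - b) (r - j) *
     rising (b - r%:R) j * rising (1 - c) (r - j) / (r - j)`!%:R.
Proof.
have f0 i : i`!%:R != 0 :> R by rewrite pnatr_eq0 -lt0n fact_gt0.
transitivity (\sum_(k < r.+1) \sum_(j < r.+1)
  (rising (1 - a) k * rising (c - b) k * rising (1 - b + k%:R) (r - k) /
   k`!%:R * ('C(r - k, j)%:R / (r - k)`!%:R) *
   rising (- l%:R) j * rising (a - c) (r - k - j))).
  apply: eq_bigr => k _; rewrite [a - c - _]addrC.
  rewrite (rising_vandermonde_wide (- l%:R) (a - c) (leq_subr k r)).
  rewrite mulr_sumr !mulr_suml; apply: eq_bigr => j _.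
  by field; rewrite !f0.
rewrite exchange_big; apply: eq_bigr => -[j] /=; rewrite ltnS => jr _.
pose m := (r - j)%N; have mr : (m <= r)%N by rewrite leq_subr.
(* For fixed j the inner sum is Pfaff-Saalschuetz of length m with A = 1 - a, B = c - b, C = 1 - b,
   so C - A - B = a - c. The factor (1 - b + m)_j splits off, and terms with k > m vanish. *)
transitivity (\sum_(k < r.+1) rising (- l%:R) j / j`!%:R / m`!%:R *
   rising (1 - b + m%:R) j * ('C(m, k)%:R * rising (1 - a) k *
   rising (c - b) k * rising (1 - b + k%:R) (m - k) *
   rising (1 - b - (1 - a) - (c - b)) (m - k))).
  apply: eq_bigr => -[k] /=; rewrite ltnS => kr _.
  rewrite bin_invfact; have [kj|kj] := leqP j (r - k).
    have km : (k <= m)%N by rewrite /m; lia.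
    have -> : (r - k - j = m - k)%N by rewrite /m; lia.
    have -> : (r - k = (m - k) + j)%N by rewrite /m; lia.
    rewrite risingD natrB//.
    have -> : 1 - b + k%:R + (m%:R - k%:R) = 1 - b + m%:R by ring.
    have -> : 1 - b - (1 - a) - (c - b) = a - c by ring.
    have /(congr1 (fun x => x * (j`!%:R)^-1)) := bin_invfact R m k.
    rewrite km => E.
    transitivity (rising (1 - a) k * rising (c - b) k * 
      rising (1 - b + k%:R) (m - k) * rising (1 - b + m%:R) j *
      rising (- l%:R) j * rising (a - c) (m - k) *
      ((k`!%:R * (m - k)`!%:R)^-1 / j`!%:R)); first by field; rewrite !f0.
    by rewrite -E; field; rewrite !f0.
  by rewrite (@bin_small m k) /m; [rewrite !(mul0r, mulr0)|lia].
rewrite -mulr_sumr pfaff_saalschutz_wide// rising_opp_nat natrM.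
(* Reflecting (b - r)_j yields (1 - b + m)_j with the same sign (-1)^j as (-l)_j. *)
have -> : b - r%:R = - (r%:R - b) by ring.
rewrite rising_opp.
have -> : r%:R - b - j%:R + 1 = 1 - b + m%:R by rewrite natrB//; ring.
have -> : 1 - b - (1 - a) = a - b by ring.
have -> : 1 - b - (c - b) = 1 - c by ring.
by rewrite -/m; field; rewrite !f0.
Qed.

(** * Euler's limit formula *)

Lemma rising_gt0 (R : realType) (z : R) n : 0 < z -> 0 < rising z n.
Proof. by move=> z0; apply: prodr_gt0 => i _; rewrite ltr_wpDr. Qed.

(** Let s be the right-hand side. Adding ln x <= x - 1 at x = t / s and x = 1 / s with weights y and
    1 - y gives y ln t - ln s <= 0, since the weighted bounds cancel. *)
Lemma bernoulli_powR (R : realType) (t y : R) :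
  0 < t -> 0 <= y <= 1 -> t `^ y <= 1 + y * (t - 1).
Proof.
move=> t0 /andP[y0 y1].
have lnB (x : R) : 0 < x -> ln x <= x - 1.
  by move=> x0; have := @le_ln1Dx R (x - 1); rewrite addrCA subrr addr0; apply; lra.
set s := 1 + _.
have s0 : 0 < s.
  have -> : s = (1 - y) + y * t by rewrite /s; ring.
  by have [->|y0'] := eqVneq y 0; [lra|nra].
rewrite -ler_ln ?posrE ?powR_gt0// ln_powR.
have h1 := lnB _ (divr_gt0 t0 s0).
have h2 : ln s^-1 <= s^-1 - 1 by apply: lnB; rewrite invr_gt0.
rewrite ln_div ?posrE// in h1; rewrite lnV ?posrE// in h2.
have h3 : y * (t / s - 1) + (1 - y) * (s^-1 - 1) = 0.
  by rewrite /s; field; rewrite -/s gt_eqF.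
nra.
Qed.

(** Euler's sequence is inverted because the reciprocal converges at every real z, to 0 at the poles
    of Gamma. *)
Definition invGamma_seq (R : realType) (z : R) (n : nat) : R :=
  rising z n / (n`!%:R * n%:R `^ (z - 1)).

Lemma natr_fact_gt0 (R : realType) n : 0 < n`!%:R :> R.
Proof. by rewrite ltr0n fact_gt0. Qed.

Lemma invGamma_seq_ge1 (R : realType) (z : R) n :
  1 <= z <= 2 -> (0 < n)%N -> 1 <= invGamma_seq z n.
Proof.
move=> /andP[z1 z2] n0.
have y01 : 0 <= z - 1 <= 1 by apply/andP; split; lra.
(* With [m.+1] under the power the bound becomes inductive: the step is Bernoulli's inequality at t
   = (m + 2) / (m + 1). *)
have H m : m`!%:R * m.+1%:R `^ (z - 1) <= rising z m.
  elim: m => [|m IH]; first by rewrite powR1 rising0 mulr1.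
  rewrite risingS; have m1 : 0 < m.+1%:R :> R by rewrite ltr0n.
  have [y0 y1] := andP y01.
  have m2 : 0 < m.+2%:R :> R by rewrite ltr0n.
  have B := bernoulli_powR (divr_gt0 m2 m1) y01.
  have {}B : (m.+2%:R / m.+1%:R) `^ (z - 1) <= (z + m%:R) / m.+1%:R.
    apply: le_trans B _.
    rewrite le_eqVlt; apply/orP; left; apply/eqP.
    by rewrite -!natr1; field; rewrite natr1 gt_eqF.
  have -> : m.+2%:R = m.+1%:R * (m.+2%:R / m.+1%:R) :> R.
    by rewrite mulrC divfK// gt_eqF.
  rewrite powRM ?divr_ge0 ?ler0n// factS natrM.
  apply: le_trans (_ : (m`!%:R * m.+1%:R `^ (z - 1)) * (z + m%:R) <= _); last first.
    by rewrite ler_wpM2r// addr_ge0//; lra.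
  have -> : m.+1%:R * m`!%:R *
     (m.+1%:R `^ (z - 1) * (m.+2%:R / m.+1%:R) `^ (z - 1)) =
     (m`!%:R * m.+1%:R `^ (z - 1)) * (m.+1%:R * (m.+2%:R / m.+1%:R) `^ (z - 1)) by ring.
  rewrite ler_wpM2l ?mulr_ge0 ?powR_ge0//.
  by rewrite mulrC -ler_pdivlMr.
have n0R : 0 < n%:R :> R by rewrite ltr0n.
rewrite /invGamma_seq ler_pdivlMr ?mul1r ?mulr_gt0 ?natr_fact_gt0 ?powR_gt0//.
apply: le_trans (H n); rewrite ler_wpM2l// ge0_ler_powR ?nnegrE//; first by lra.
by rewrite ler_nat.
Qed.

(** Bernoulli's inequality at t = (n + 1) / (n + 2). Indices start at 1 because at 0 the power of 0
    is degenerate. *)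
Lemma invGamma_seq_nonincr (R : realType) (z : R) n :
  1 <= z <= 2 -> invGamma_seq z n.+2 <= invGamma_seq z n.+1.
Proof.
move=> /andP[z1 z2]; rewrite /invGamma_seq risingS factS natrM.
have y01 : 0 <= z - 1 <= 1 by apply/andP; split; lra.
have m1 : 0 < n.+1%:R :> R by rewrite ltr0n.
have m2 : 0 < n.+2%:R :> R by rewrite ltr0n.
have B := bernoulli_powR (divr_gt0 m1 m2) y01.
have E : n.+1%:R `^ (z - 1) =
    n.+2%:R `^ (z - 1) * (n.+1%:R / n.+2%:R) `^ (z - 1) :> R.
  by rewrite -powRM ?divr_ge0// mulrCA divff ?mulr1// gt_eqF.
have q0 : 0 < (n.+1%:R / n.+2%:R) `^ (z - 1) :> R.
  by apply: powR_gt0; exact: divr_gt0.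
set q := _ `^ (z - 1) in B q0 E.
have p0 : 0 < n.+2%:R `^ (z - 1) :> R by rewrite powR_gt0.
rewrite E; move: (n.+2%:R `^ _) p0 => p p0.
have f0 := natr_fact_gt0 R n.+1.
have r0 : 0 < rising z n.+1 by apply: rising_gt0; lra.
have -> : rising z n.+1 * (z + n.+1%:R) / (n.+2%:R * (n.+1)`!%:R * p) =
  rising z n.+1 / ((n.+1)`!%:R * p) * ((z + n.+1%:R) / n.+2%:R).
  by field; rewrite !gt_eqF//=.
have -> : rising z n.+1 / ((n.+1)`!%:R * (p * q)) =
  rising z n.+1 / ((n.+1)`!%:R * p) * q^-1.
  by field; rewrite !gt_eqF//=.
rewrite ler_wpM2l ?divr_ge0 ?mulr_ge0 ?(ltW r0) ?(ltW p0)//.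
rewrite -[q^-1]mul1r ler_pdivlMr//.
apply: le_trans (ler_wpM2l _ B) _; first by rewrite divr_ge0//; lra.
have -> : 1 + (z - 1) * (n.+1%:R / n.+2%:R - 1) =
  (n.+2%:R - (z - 1)) / n.+2%:R :> R.
  by rewrite -!natr1; field; rewrite !natr1 gt_eqF.
rewrite mulrACA -invfM ler_pdivrMr ?mulr_gt0// mul1r.
(* With N = n + 2 and y = z - 1, what remains is (N + y) (N - y) <= N^2. *)
rewrite -!natr1; nra.
Qed.

Lemma cvg_natr_div (R : realType) (z : R) :
  n%:R / (z + n%:R) @[n --> \oo] --> (1 : R).
Proof.
have H : (fun n : nat => (1 + z * n%:R^-1)^-1 : R) @ \oo --> (1 + z * 0)^-1.
  apply: cvgV; first by rewrite mulr0 addr0 oner_neq0.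
  apply: cvgD; first exact: cvg_cst.
  apply: cvgM; first exact: cvg_cst.
  by rewrite -(cvg_shiftS (fun n : nat => n%:R^-1 : R)); exact: cvg_harmonic.
rewrite mulr0 addr0 invr1 in H.
apply: cvg_trans H; apply: near_eq_cvg; near=> n.
have n0 : n%:R != 0 :> R by rewrite pnatr_eq0 -lt0n; near: n; exists 1%N.
have -> : 1 + z / n%:R = (z + n%:R) / n%:R by field.
by rewrite invf_div.
Unshelve. all: by end_near. Qed.

Lemma near_addn_neq0 (R : realType) (z : R) :
  \forall n \near \oo, z + n%:R != 0.
Proof.
exists (Num.truncn `|z|).+1 => //= n /= zn.
have : `|z| < n%:R.
  by apply: lt_le_trans (truncnS_gt _) _; rewrite ler_nat.
by rewrite ltr_norml => /andP[? _]; rewrite gt_eqF//; lra.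
Qed.

(** Finite form of 1/Gamma(z) = z/Gamma(z + 1), kept free of division so that it also holds at
    poles. *)
Lemma invGamma_seq_shift (R : realType) (z : R) n : (0 < n)%N ->
  invGamma_seq z n * (z + n%:R) = z * invGamma_seq (z + 1) n * n%:R.
Proof.
move=> n0; have n0R : n%:R != 0 :> R by rewrite pnatr_eq0 -lt0n.
have E : rising z n * (z + n%:R) = z * rising (z + 1) n.
  by rewrite -risingS risingSl.
have p0 : n%:R `^ (z - 1) != 0 :> R by rewrite gt_eqF// powR_gt0 ?ltr0n.
rewrite /invGamma_seq mulrAC E addrK.
have -> : n%:R `^ z = n%:R `^ (z - 1) * n%:R :> R.
  by rewrite -[z in LHS](subrK 1) (@powRD _ _ (z - 1) 1) ?n0R ?implybT// powRr1.
by field; rewrite p0 n0R gt_eqF// natr_fact_gt0.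
Qed.

Lemma cvg_invGamma_seq_pred (R : realType) (z x : R) :
  invGamma_seq (z + 1) @ \oo --> x -> invGamma_seq z @ \oo --> z * x.
Proof.
move=> H; rewrite -[_ * x]mulr1.
apply: cvg_trans (cvgM (cvgM (cvg_cst z) H) (cvg_natr_div z)).
apply: near_eq_cvg; near=> n => /=.
have zn : z + n%:R != 0 by near: n; exact: near_addn_neq0.
apply: (mulIf zn); rewrite invGamma_seq_shift; last by near: n; exists 1%N.
by rewrite mulrA divfK.
Unshelve. all: by end_near. Qed.

Lemma cvg_invGamma_seq_succ (R : realType) (z x : R) : z != 0 ->
  invGamma_seq z @ \oo --> x -> invGamma_seq (z + 1) @ \oo --> x / z.
Proof.
move=> z0 H.
rewrite -[_ / z]mulr1 -[X in _ * X]invr1.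
apply: cvg_trans (cvgM (cvgM H (cvg_cst z^-1))
  (cvgV (oner_neq0 _) (cvg_natr_div z))).
apply: near_eq_cvg; near=> n => /=.
have n0 : (0 < n)%N by near: n; exists 1%N.
have n0R : n%:R != 0 :> R by rewrite pnatr_eq0 -lt0n.
have -> : invGamma_seq z n / z / (n%:R / (z + n%:R)) =
    invGamma_seq z n * (z + n%:R) / (z * n%:R).
  by rewrite invf_div invfM; ring.
by rewrite invGamma_seq_shift//; field; rewrite n0R.
Unshelve. all: by end_near. Qed.

Lemma Gamma_poleN (R : realType) (z : R) :
  ~~ Gamma_pole z -> forall n : nat, z + n%:R != 0.
Proof.
move=> zp n; apply: contra zp => /eqP zn; rewrite /Gamma_pole.
by have -> : - z = n%:R by lra.
Qed.

(** On [1, 2] the sequence decreases and stays above 1. The shift carries this up to z >= 1 and down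
    to z < 1, where the factors z + i are nonzero away from the poles. *)
Lemma is_cvg_invGamma_seq (R : realType) (z : R) : ~~ Gamma_pole z ->
  exists2 x, invGamma_seq z @ \oo --> x & x != 0.
Proof.
have base (y : R) : 1 <= y <= 2 -> exists2 x, invGamma_seq y @ \oo --> x & x != 0.
  move=> y12; pose u n := invGamma_seq y n.+1.
  have cu : cvgn u.
    apply: nonincreasing_is_cvgn.
      by apply/nonincreasing_seqP => n; exact: invGamma_seq_nonincr.
    by exists 1 => _ [n _ <-]; exact: invGamma_seq_ge1.
  exists (limn u); first by rewrite -cvg_shiftS.
  rewrite gt_eqF// (lt_le_trans ltr01)//; apply: limr_ge => //.
  by apply: nearW => n; exact: invGamma_seq_ge1.
move=> zp; have [z1|z1] := leP 1 z.
  have y12 : 1 <= z - (Num.truncn (z - 1))%:R <= 2.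
    have /truncn_itv/andP[] : 0 <= z - 1 by lra.
    by rewrite -natr1 => ? ?; apply/andP; split; lra.
  move: (Num.truncn _) y12 => m y12.
  suff H i : exists2 x, invGamma_seq (z - m%:R + i%:R) @ \oo --> x & x != 0.
    by have := H m; rewrite subrK.
  elim: i => [|i [x xc x0]]; first by rewrite addr0; exact: base.
  have w0 : z - m%:R + i%:R != 0.
    have /andP[m1 _] := y12.
    by rewrite gt_eqF// (lt_le_trans ltr01)// (le_trans m1)// lerDl.
  exists (x / (z - m%:R + i%:R)); last by rewrite mulf_neq0 ?invr_neq0.
  by rewrite -natr1 addrA; exact: cvg_invGamma_seq_succ.
pose m := Num.truncn (2 - z).
have y12 : 1 <= z + m%:R <= 2.
  have /truncn_itv/andP[] : 0 <= 2 - z by lra.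
  by rewrite -/m -natr1 => ? ?; apply/andP; split; lra.
have {y12} := base _ y12; elim: (m) => [|i IH]; first by rewrite addr0.
case=> x; rewrite -natr1 addrA => xc x0; apply: IH.
exists ((z + i%:R) * x); first exact: cvg_invGamma_seq_pred.
by rewrite mulf_neq0// Gamma_poleN.
Qed.

Lemma rising_pole (R : realType) (m n : nat) :
  (m < n)%N -> rising (- m%:R : R) n = 0.
Proof. by move=> mn; rewrite rising_opp_nat bin_small// mul0n mulr0. Qed.

Lemma invGamma_cvg_neq0 (R : realType) (z : R) : ~~ Gamma_pole z ->
  invGamma_seq z @ \oo --> invGamma z /\ invGamma z != 0.
Proof.
move=> zp; have [x xc x0] := is_cvg_invGamma_seq zp.
suff -> : invGamma z = x by [].
rewrite /invGamma (negbTE zp) -[RHS]invrK; congr (_^-1).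
apply/cvg_lim => //.
apply: cvg_trans (cvgV x0 xc); apply: near_eq_cvg; apply: nearW => n /=.
by rewrite /invGamma_seq invf_div.
Qed.

(** At a pole z = -m, (z)_n vanishes for n > m, so the limit agrees with the convention
    [invGamma z = 0]. *)
Lemma invGamma_cvg (R : realType) (z : R) :
  invGamma_seq z @ \oo --> invGamma z.
Proof.
have [zp|zp] := boolP (Gamma_pole z); last by case: (invGamma_cvg_neq0 zp).
rewrite /invGamma zp; have /natrP[m zm] := zp.
apply: (@cvg_trans _ ((fun=> 0 : R) @ \oo)); last exact: cvg_cst.
apply: near_eq_cvg.
exists m.+1 => //= n /= mn.
by rewrite /invGamma_seq -[z]opprK zm rising_pole// mul0r.
Qed.

Lemma invGamma_neq0 (R : realType) (z : R) : ~~ Gamma_pole z -> invGamma z != 0.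
Proof. by case/invGamma_cvg_neq0. Qed.

Lemma GammaE (R : realType) (z : R) : ~~ Gamma_pole z -> Gamma z = (invGamma z)^-1.
Proof. by move=> zp; rewrite /invGamma (negbTE zp) invrK. Qed.

(** Obtained from limits of [invGamma_seq], hence valid at poles too. *)
Lemma invGamma_rising (R : realType) (z : R) m :
  invGamma z = rising z m * invGamma (z + m%:R).
Proof.
elim: m => [|m IH]; first by rewrite rising0 mul1r addr0.
rewrite IH risingS -mulrA; congr (_ * _); rewrite -natr1 addrA.
have := cvg_invGamma_seq_pred (@invGamma_cvg R (z + m%:R + 1)).
by apply: cvg_unique => //; exact: invGamma_cvg.
Qed.

Lemma invGamma1 (R : realType) : invGamma (1 : R) = 1.
Proof.
apply: (cvg_unique _ (@invGamma_cvg R _)) => //.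
have -> : @invGamma_seq R 1 = fun=> 1; last exact: cvg_cst.
apply/funext => n; rewrite /invGamma_seq subrr powRr0 mulr1 rising1.
by rewrite divff// gt_eqF ?natr_fact_gt0.
Qed.

Lemma invGamma_natS (R : realType) n : invGamma (n.+1%:R : R) = (n`!%:R)^-1.
Proof.
have := invGamma_rising (1 : R) n; rewrite invGamma1 rising1 nat1r => E.
have f0 : n`!%:R != 0 :> R by rewrite gt_eqF ?natr_fact_gt0.
by apply: (mulfI f0); rewrite -E mulfV.
Qed.

(** * Gauss's summation theorem *)

Lemma cvg_natr_powRN (R : realType) (d : R) : 0 < d ->
  n%:R `^ (- d) @[n --> \oo] --> (0 : R).
Proof.
move=> d0.
apply: (@cvg_trans _ ((fun n : nat => (n%:R^-1 : R) `^ d) @ \oo)).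
  by apply: near_eq_cvg; apply: nearW => n; rewrite powRN -powR_inv1// -powRrM mulN1r powRN.
apply: (cvg_comp _ _ _ (powR_cvg0 d0)).
move=> P [e /= e0 eP]; have H : (n%:R^-1 : R) @[n --> \oo] --> (0 : R).
  by rewrite -(cvg_shiftS (fun n : nat => n%:R^-1 : R)); exact: cvg_harmonic.
near=> n; apply: eP => /=.
  by rewrite sub0r normrN; near: n; exact: (cvgr0_norm_lt _ H).
by rewrite invr_gt0 ltr0n; near: n; exists 1%N.
Unshelve. all: by end_near. Qed.

(** The k-th term of the Gauss series 2F1(A, B; G; 1). *)
Definition gauss_term (R : realType) (A B G : R) (k : nat) : R :=
  rising A k * rising B k / (rising G k * k`!%:R).

Lemma rising_neq0 (R : realType) (z : R) n : ~~ Gamma_pole z -> rising z n != 0.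
Proof. by move=> zp; rewrite /rising; apply/prodf_neq0 => i _; rewrite Gamma_poleN. Qed.

Lemma gt0_Gamma_pole (R : realType) (z : R) : 0 < z -> ~~ Gamma_pole z.
Proof. by move=> z0; apply/negP => /natr_ge0; rewrite oppr_ge0 leNgt z0. Qed.

Lemma Gamma_poleD (R : realType) (z : R) (n : nat) :
  ~~ Gamma_pole z -> ~~ Gamma_pole (z + n%:R).
Proof.
apply: contra; rewrite /Gamma_pole => H.
have -> : - z = - (z + n%:R) + n%:R by ring.
by rewrite rpredD// natr_nat.
Qed.

(** Factorials cancel and the powers of k combine, which exposes the decay k^(A + B - G - 1) of the
    Gauss term. *)
Lemma gauss_term_powR (R : realType) (A B G : R) k : (0 < k)%N ->
  gauss_term A B G k * k%:R `^ (G - A - B + 1) =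
  invGamma_seq A k * invGamma_seq B k / invGamma_seq G k.
Proof.
move=> k0; have k0R : k%:R != 0 :> R by rewrite pnatr_eq0 -lt0n.
have f0 : k`!%:R != 0 :> R by rewrite gt_eqF ?natr_fact_gt0.
have p0 x : k%:R `^ x != 0 :> R by rewrite gt_eqF// powR_gt0 ?ltr0n.
have -> : G - A - B + 1 = (G - 1) - (A - 1) - (B - 1) by ring.
rewrite powRB ?k0R ?implybT// powRB ?k0R ?implybT//.
rewrite /invGamma_seq /gauss_term !invfM !invrK.
have := p0 (A - 1); have := p0 (B - 1).
move: (_ `^ (A - 1)) (_ `^ (B - 1)) (_ `^ (G - 1)) (_^-1) => p q s g q0 pp0.
by field; rewrite q0 pp0 f0.
Qed.

Lemma gauss_term_cvg (R : realType) (A B G : R) : ~~ Gamma_pole G ->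
  gauss_term A B G k * k%:R `^ (G - A - B + 1) @[k --> \oo] -->
  invGamma A * invGamma B / invGamma G.
Proof.
move=> Gp; apply: (@cvg_trans _ ((fun k =>
   invGamma_seq A k * invGamma_seq B k / invGamma_seq G k) @ \oo)).
  apply: near_eq_cvg; by exists 1%N => // k /= k0; rewrite gauss_term_powR.
apply: cvgM; first by apply: cvgM; exact: invGamma_cvg.
by apply: cvgV; [exact: invGamma_neq0|exact: invGamma_cvg].
Qed.

(** Disposes of the boundary term of the summed contiguous relation. *)
Lemma gauss_term_natM_cvg0 (R : realType) (A B G : R) :
  ~~ Gamma_pole G -> 0 < G - A - B ->
  k%:R * gauss_term A B G k @[k --> \oo] --> 0.
Proof.
move=> Gp d0; rewrite -(mulr0 (invGamma A * invGamma B / invGamma G)).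
apply: cvg_trans (cvgM (@gauss_term_cvg _ A B _ Gp) (cvg_natr_powRN d0)).
apply: near_eq_cvg.
exists 1%N => // k /= k0; have k0R : k%:R != 0 :> R by rewrite pnatr_eq0 -lt0n.
rewrite -mulrA -powRD ?k0R ?implybT//.
by rewrite addrAC subrr add0r powRr1// mulrC.
Qed.

(* The telescoping identity
   [d k! / (1+d)_(k+1) = k! / (1+d)_k - (k+1)! / (1+d)_(k+1)]
   provides a comparison series decaying like [k ^ (- d - 1)]. *)
Lemma is_cvg_fact_div_rising (R : realType) (d : R) : 0 < d ->
  cvgn (series (fun k => k`!%:R / rising (1 + d) k.+1)).
Proof.
move=> d0; have r0 k : 0 < rising (1 + d) k by apply: rising_gt0; lra.
pose w k : R := k`!%:R / rising (1 + d) k.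
have E k : k`!%:R / rising (1 + d) k.+1 = - d^-1 * (w k.+1 - w k).
  have h := r0 k; have h' : 0 < 1 + d + k%:R by rewrite ltr_wpDr//; lra.
  rewrite /w risingS factS natrM -natr1; field.
  by rewrite !gt_eqF.
apply: nondecreasing_is_cvgn.
  apply/nondecreasing_seqP => n; rewrite /series /= big_nat_recr//= lerDl.
  by rewrite divr_ge0// ltW.
exists d^-1 => _ [n _ <-]; rewrite /series /=.
under eq_bigr do rewrite E.
rewrite -mulr_sumr telescope_sumr// mulNr -mulrN opprB.
rewrite ler_piMr ?invr_ge0 ?(ltW d0)// /w rising0 divr1.
by rewrite lerBlDr lerDl divr_ge0// ltW.
Qed.

(** Term and comparison term [v] both decay like k^(-d-1), so their ratio converges and is bounded.
    Absolute convergence serves the tail estimate for large G. *)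
Lemma gauss_term_normed_cvg (R : realType) (A B G : R) :
  ~~ Gamma_pole G -> 0 < G - A - B ->
  cvgn [normed series (gauss_term A B G)].
Proof.
move=> Gp d0; set d := G - A - B in d0 *.
pose v k : R := k`!%:R / rising (1 + d) k.+1.
have r0 k : 0 < rising (1 + d) k by apply: rising_gt0; lra.
have v0 k : 0 < v k by rewrite divr_gt0// natr_fact_gt0.
have cvg_ratio : cvgn (fun k => gauss_term A B G k / v k).
  apply/cvg_ex; exists (invGamma A * invGamma B / invGamma G *
    invGamma (1 + d) * 1^-1).
  (* For k > 0, 1 / [v k] is [invGamma_seq (1 + d) k] times (1 + d + k) / k times k^(d + 1), and the
     last power is the one in [gauss_term_cvg]. *)
  have nd : (fun k : nat => (k%:R / (1 + d + k%:R))^-1 : R) @ \oo --> (1 : R)^-1.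
    by apply: cvgV (cvg_natr_div _); exact: oner_neq0.
  apply: cvg_trans (cvgM (cvgM (@gauss_term_cvg _ A B _ Gp)
    (@invGamma_cvg R (1 + d))) nd).
  apply: near_eq_cvg; exists 1%N => // k /= k0.
  have k0R : k%:R != 0 :> R by rewrite pnatr_eq0 -lt0n.
  have p0 : k%:R `^ d != 0 :> R by rewrite gt_eqF// powR_gt0 ?ltr0n.
  rewrite /v risingS -/d powRD ?k0R ?implybT// powRr1//.
  rewrite /invGamma_seq (addrC 1 d) addrK.
  have f0 : k`!%:R != 0 :> R by rewrite gt_eqF ?natr_fact_gt0.
  have z0 : d + 1 + k%:R != 0 by rewrite gt_eqF// ltr_wpDr//; lra.
  have rk0 : rising (d + 1) k != 0 by rewrite gt_eqF// addrC.
  by field; rewrite rk0 z0 k0R p0 f0.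
have [M [Mr HM]] := cvg_seq_bounded cvg_ratio.
have {}HM k : `|gauss_term A B G k| <= (`|M| + 1) * v k.
  have := HM (`|M| + 1) _ k Logic.I; rewrite /= normrM normfV.
  rewrite (gtr0_norm (v0 k)) ler_pdivrMr//; apply.
  by rewrite (le_lt_trans (ler_norm M))// ltrDl.
apply: (@series_le_cvg _ (fun k => `|gauss_term A B G k|)
   (fun k => (`|M| + 1) * v k)) => //.
  by move=> k; rewrite mulr_ge0 ?(ltW (v0 k))// addr_ge0.
have -> : (fun k => (`|M| + 1) * v k) = (`|M| + 1) *: v by [].
rewrite seriesZ; apply: is_cvgZr; exact: is_cvg_fact_div_rising.
Qed.

Lemma gauss_term_is_cvg (R : realType) (A B G : R) :
  ~~ Gamma_pole G -> 0 < G - A - B -> cvgn (series (gauss_term A B G)).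
Proof. by move=> ? ?; apply/normed_cvg/gauss_term_normed_cvg. Qed.

(** Termwise the two sides differ by [U k.+1 - U k], where U k is -G k times the k-th Gauss term, so
    the sum telescopes. *)
Lemma gauss_term_contiguous_sum (R : realType) (A B G : R) n :
  ~~ Gamma_pole G ->
  G * (G - A - B) * series (gauss_term A B G) n =
  (G - A) * (G - B) * series (gauss_term A B (G + 1)) n -
  G * (n%:R * gauss_term A B G n).
Proof.
move=> Gp; pose U k := - G * (k%:R * gauss_term A B G k).
apply/eqP; rewrite -subr_eq0; apply/eqP.
rewrite -(_ : U n - U 0%N = - (G * (n%:R * gauss_term A B G n))); last first.
  by rewrite /U mul0r mulr0 subr0 mulNr.
rewrite -telescope_sumr// /series /= !mulr_sumr -big_split /= -sumrB.
apply: big1 => k _; rewrite /U /gauss_term.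
have g0 := Gamma_poleN Gp 0; rewrite addr0 in g0.
have gk := Gamma_poleN Gp k.
have rk : rising G k != 0 by exact: rising_neq0.
have -> : rising (G + 1) k = rising G k * (G + k%:R) / G.
  by rewrite -risingS risingSl mulrC mulKf.
rewrite !risingS factS natrM -!natr1.
have f0 : k`!%:R != 0 :> R by rewrite gt_eqF ?natr_fact_gt0.
have k1 : k%:R + 1 != 0 :> R by rewrite natr1 pnatr_eq0.
by field; rewrite g0 gk rk f0 k1.
Qed.

Lemma gauss_term_contiguous (R : realType) (A B G : R) :
  ~~ Gamma_pole G -> 0 < G - A - B ->
  G * (G - A - B) * limn (series (gauss_term A B G)) =
  (G - A) * (G - B) * limn (series (gauss_term A B (G + 1))).
Proof.
move=> Gp d0.
have Gp1 : ~~ Gamma_pole (G + 1) by exact: (Gamma_poleD 1).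
have d1 : 0 < G + 1 - A - B by lra.
have h : (fun n => G * (G - A - B) * series (gauss_term A B G) n) @ \oo -->
    G * (G - A - B) * limn (series (gauss_term A B G)).
  by apply: cvgM; [exact: cvg_cst|exact: gauss_term_is_cvg].
apply: (cvg_unique _ h) => //.
rewrite -[(G - A) * (G - B) * _]subr0 -(mulr0 G).
apply: cvg_trans (cvgB (cvgM (cvg_cst _) (gauss_term_is_cvg Gp1 d1))
  (cvgM (cvg_cst G) (gauss_term_natM_cvg0 Gp d0))).
apply: near_eq_cvg; apply: nearW => n /=.
by rewrite gauss_term_contiguous_sum.
Qed.

(** The first factor of the denominator supplies G / (G + m); the other factors only grow with m.
    The index [k.+1] leaves out the constant term. *)
Lemma gauss_term_tail_le (R : realType) (A B G : R) m k : 0 < G ->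
  `|gauss_term A B (G + m%:R) k.+1| <=
  G / (G + m%:R) * `|gauss_term A B G k.+1|.
Proof.
move=> G0; have Gm : 0 < G + m%:R by rewrite ltr_wpDr.
have Gk : 0 < rising G k.+1 by exact: rising_gt0.
have Gmk : 0 < rising (G + m%:R) k.+1 by exact: rising_gt0.
have f0 : 0 < k.+1`!%:R :> R by exact: natr_fact_gt0.
rewrite /gauss_term normrM [`|_ / (rising G _ * _)|]normrM mulrCA.
rewrite ler_wpM2l// !gtr0_norm ?invr_gt0 ?mulr_gt0//.
rewrite !invfM mulrA ler_wpM2r ?invr_ge0 ?(ltW f0)//.
rewrite ler_pdivlMr// mulrC ler_pdivrMr//.
rewrite !risingSl -mulrA mulKf ?gt_eqF// ler_pM2l// /rising.
apply: ler_prod => i _; rewrite addr_ge0 ?addr_ge0 ?(ltW G0)//=.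
by rewrite !lerD2r lerDl.
Qed.

(** Only the constant term 1 survives: the rest is at most G / (G + m) times the absolute sum [S] of
    the series at m = 0. *)
Lemma gauss_term_lim1_pos (R : realType) (A B G : R) :
  0 < G -> 0 < G - A - B ->
  limn (series (gauss_term A B (G + m%:R))) @[m --> \oo] --> (1 : R).
Proof.
move=> G0 d0; have Gp := gt0_Gamma_pole G0.
have cN := gauss_term_normed_cvg Gp d0.
set S := limn [normed series (gauss_term A B G)].
have nS n : [normed series (gauss_term A B G)] n <= S.
  apply: nondecreasing_cvgn_le => //; apply/nondecreasing_seqP => k.
  by rewrite /= /series /= big_nat_recr//= lerDl.
have bound m n : `|series (gauss_term A B (G + m%:R)) n.+1 - 1| <=
    G / (G + m%:R) * S.
  rewrite /series /= big_nat_recl//= {1}/gauss_term !rising0 fact0 !mulr1 divr1.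
  rewrite addrAC subrr add0r; apply: le_trans (ler_norm_sum _ _ _) _.
  apply: le_trans (ler_wpM2l _ (nS n.+1)); last first.
    by rewrite divr_ge0 ?addr_ge0// ltW.
  rewrite /= /series /= big_nat_recl//= mulrDr ler_wpDl//.
    by rewrite mulr_ge0// divr_ge0 ?addr_ge0// ltW.
  by rewrite mulr_sumr; apply: ler_sum => k _; exact: gauss_term_tail_le.
have c0 : (fun m : nat => G / (G + m%:R) * S) @ \oo --> (0 : R).
  have : (fun m : nat => (1 - m%:R / (G + m%:R)) * S : R) @ \oo --> (1 - 1) * S.
    apply: cvgM; last exact: cvg_cst.
    by apply: cvgB; [exact: cvg_cst|exact: cvg_natr_div].
  rewrite subrr mul0r; apply: cvg_trans.
  apply: near_eq_cvg; apply: nearW => m /=; congr (_ * S).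
  have Gm : G + m%:R != 0 by rewrite gt_eqF// ltr_wpDr.
  by field.
apply/cvgrPdist_lt => /= e e0.
near=> m.
have mlt : `|G / (G + m%:R) * S| < e by near: m; exact: (cvgr0_norm_lt _ c0).
rewrite distrC; apply: le_lt_trans mlt.
rewrite [leRHS]ger0_norm; last by apply: le_trans (bound m 0); exact: normr_ge0.
have Gmp : ~~ Gamma_pole (G + m%:R) by exact: Gamma_poleD.
have dm : 0 < G + m%:R - A - B by have := ler0n R m; lra.
have cm := gauss_term_is_cvg Gmp dm.
have H : (fun n => `|series (gauss_term A B (G + m%:R)) n - 1|) @ \oo -->
   `|limn (series (gauss_term A B (G + m%:R))) - 1|.
  by apply: cvg_norm; apply: cvgB => //; exact: cvg_cst.
rewrite -(cvg_lim _ H)//; apply: limr_le; first by apply/cvg_ex; eexists; exact: H.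
by exists 1%N => // -[//|n] _; exact: bound.
Unshelve. all: by end_near. Qed.

Lemma gauss_term_lim1 (R : realType) (A B G : R) : 0 < G - A - B ->
  limn (series (gauss_term A B (G + m%:R))) @[m --> \oo] --> (1 : R).
Proof.
move=> d0; pose m0 := (Num.truncn `|G|).+1.
have G0 : 0 < G + m0%:R.
  have := truncnS_gt `|G|; rewrite -/m0.
  by rewrite ltr_norml => /andP[? _]; lra.
have d0' : 0 < G + m0%:R - A - B by have := ler0n R m0; lra.
rewrite -(cvg_shiftn m0 (fun m => limn (series (gauss_term A B (G + m%:R))))).
have := gauss_term_lim1_pos G0 d0'; apply: cvg_trans.
apply: near_eq_cvg; apply: nearW => n /=.
by rewrite addnC natrD addrA.
Qed.

Lemma gauss_summation (R : realType) (A B G : R) :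
  ~~ Gamma_pole G -> 0 < G - A - B ->
  series (gauss_term A B G) @ \oo -->
  invGamma (G - A) * invGamma (G - B) / (invGamma G * invGamma (G - A - B)).
Proof.
move=> Gp d0.
set d := G - A - B in d0 *; have dp := gt0_Gamma_pole d0.
pose F m := limn (series (gauss_term A B (G + m%:R))).
(* The contiguous relation iterated m times. *)
have E m : F 0 = rising (G - A) m * rising (G - B) m / (rising G m * rising d m) * F m.
  elim: m => [|m IH]; first by rewrite !rising0 !mulr1 divr1 mul1r.
  rewrite IH !risingS.
  have Gm := Gamma_poleD m Gp.
  have dm : 0 < G + m%:R - A - B by have := ler0n R m; move: d0; rewrite /d; lra.
  have := gauss_term_contiguous Gm dm; rewrite -[G + _ + 1]addrA natr1 -/(F m) -/(F m.+1).
  have g0 := Gamma_poleN Gp m; have dd0 := Gamma_poleN dp m.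
  have g1 := rising_neq0 m Gp; have d1 := rising_neq0 m dp.
  have -> : G + m%:R - A - B = d + m%:R by rewrite /d; ring.
  have -> : G + m%:R - A = G - A + m%:R by ring.
  have -> : G + m%:R - B = G - B + m%:R by ring.
  move=> h; have {h} -> : F m =
    (G - A + m%:R) * (G - B + m%:R) / ((G + m%:R) * (d + m%:R)) * F m.+1.
    by rewrite mulrAC -h mulrAC mulfV ?mul1r// mulf_neq0.
  by field; rewrite g0 dd0 g1 d1.
suff <- : F 0 = invGamma (G - A) * invGamma (G - B) / (invGamma G * invGamma d).
  by rewrite /F addr0; exact: gauss_term_is_cvg.
have h : (fun m => invGamma_seq (G - A) m * invGamma_seq (G - B) m /
     (invGamma_seq G m * invGamma_seq d m) * F m) @ \oo -->
   invGamma (G - A) * invGamma (G - B) / (invGamma G * invGamma d) * 1.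
  apply: cvgM; last exact: gauss_term_lim1.
  apply: cvgM; first by apply: cvgM; exact: invGamma_cvg.
  apply: cvgV; first by rewrite mulf_neq0// invGamma_neq0.
  by apply: cvgM; exact: invGamma_cvg.
rewrite mulr1 in h; apply: (cvg_unique _ _ h) => //.
apply: (@cvg_trans _ ((fun=> F 0) @ \oo)); last exact: cvg_cst.
apply: near_eq_cvg; exists 1%N => // m /= m0.
rewrite (E m); congr (_ * _).
have p0 x : m%:R `^ x != 0 :> R by rewrite gt_eqF// powR_gt0 ?ltr0n.
have m0R : m%:R != 0 :> R by rewrite pnatr_eq0 -lt0n.
have f0 : m`!%:R != 0 :> R by rewrite gt_eqF ?natr_fact_gt0.
have g1 := rising_neq0 m Gp; have d1 := rising_neq0 m dp.
(* Since (G - A) + (G - B) = G + d, the powers of m cancel and the quotient of rising factorials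
   equals that of the Euler sequences. *)
have P : m%:R `^ (G - A - 1) * m%:R `^ (G - B - 1) =
         m%:R `^ (G - 1) * m%:R `^ (d - 1) :> R.
  rewrite -!powRD ?m0R ?implybT//; congr (_ `^ _); rewrite /d; ring.
rewrite /invGamma_seq.
set x := rising (G - A) m * _; set y := rising G m * _.
symmetry; transitivity (x / y * (m%:R `^ (G - 1) * m%:R `^ (d - 1) /
   (m%:R `^ (G - A - 1) * m%:R `^ (G - B - 1)))).
  by rewrite /x /y; field; rewrite !p0 f0 g1 d1.
by rewrite P mulfV ?mulr1// mulf_neq0.
Qed.

(** * Reduction of the 3F2 to Gauss series *)

(* [(a)_k / (a - l)_k = (a - l + k)_l / (a - l)_l] is expanded in the basis
   [(b - s + k)_j], which merges with [(b - s)_k] into [(b - s)_j (b - s + j)_k]. *)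
Lemma hyp3F2_term_gauss (R : realType) (a b c s : R) l k :
  rising (a - l%:R) l != 0 -> (rising (a - l%:R) k = 0 -> rising c k = 0) ->
  hyp3F2_term a (b - s) c (a - l%:R) (b + 1) 1 k =
  \sum_(j < l.+1) 'C(l, j)%:R * rising (b - s) j *
    rising (a - b - l%:R + s) (l - j) / rising (a - l%:R) l *
    gauss_term c (b - s + j%:R) (b + 1) k.
Proof.
(* Past the end of a terminating series (a - l)_k may vanish, but there (c)_k = 0 makes both sides
   0. *)
move=> l0 ck; have [ck0|ck0] := eqVneq (rising c k) 0.
  rewrite /hyp3F2_term ck0 mulr0 !mul0r big1// => j _.
  by rewrite /gauss_term ck0 !mul0r mulr0.
have ak0 : rising (a - l%:R) k != 0 by apply: contra ck0 => /eqP/ck ->.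
have H : rising a k / rising (a - l%:R) k =
    rising (a - l%:R + k%:R) l / rising (a - l%:R) l.
  have E : rising (a - l%:R) l * rising a k =
      rising (a - l%:R) k * rising (a - l%:R + k%:R) l.
    by rewrite -[X in _ * rising X k](subrK l%:R a) -!risingD addnC.
  by apply/eqP; rewrite eqr_div// mulrC E mulrC.
transitivity (rising (b - s) k * rising c k / (rising (b + 1) k * k`!%:R) *
   (rising a k / rising (a - l%:R) k)).
  rewrite /hyp3F2_term expr1n !invfM mul1r; ring.
rewrite H.
have -> : a - l%:R + k%:R = (b - s + k%:R) + (a - b - l%:R + s) by ring.
rewrite (rising_vandermonde (b - s + k%:R) (a - b - l%:R + s)) mulr_suml mulr_sumr.
apply: eq_bigr => j _.
have E : rising (b - s) k * rising (b - s + k%:R) j =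
         rising (b - s) j * rising (b - s + j%:R) k.
  by rewrite -!risingD addnC.
rewrite /gauss_term [in RHS]mulrA.
transitivity ('C(l, j)%:R * (rising (b - s) k * rising (b - s + k%:R) j) *
   rising (a - b - l%:R + s) (l - j) / rising (a - l%:R) l * rising c k /
   (rising (b + 1) k * k`!%:R)); first by ring.
by rewrite E; ring.
Qed.

(** The j-th Gauss series has excess G - A - B = 1 + s - j - c, smallest at j = l, where
    [c < s + 1 - l%:R] makes it positive. *)
Lemma hyp3F2_cvg (R : realType) (a b c s : R) l :
  c < s + 1 - l%:R -> ~~ Gamma_pole (1 + b) -> rising (a - l%:R) l != 0 ->
  (forall k, rising (a - l%:R) k = 0 -> rising c k = 0) ->
  series (hyp3F2_term a (b - s) c (a - l%:R) (b + 1) 1) @ \oo -->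
  \sum_(j < l.+1) 'C(l, j)%:R * rising (b - s) j *
    rising (a - b - l%:R + s) (l - j) / rising (a - l%:R) l *
    (invGamma (1 + b - c) * invGamma (1 + s - j%:R) /
      (invGamma (1 + b) * invGamma (1 + s - j%:R - c))).
Proof.
move=> hc hb l0 ck.
pose p j := 'C(l, j)%:R * rising (b - s) j *
    rising (a - b - l%:R + s) (l - j) / rising (a - l%:R) l.
have -> : series (hyp3F2_term a (b - s) c (a - l%:R) (b + 1) 1) =
   fun n => \sum_(j < l.+1) p j * series (gauss_term c (b - s + j%:R) (b + 1)) n.
  apply/funext => n; rewrite /series /=.
  rewrite (eq_bigr _ (fun k _ => hyp3F2_term_gauss b s l0 (ck k))).
  by rewrite exchange_big /=; apply: eq_bigr => j _; rewrite mulr_sumr.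
apply: cvg_big => [|[j jl] _]; first exact: add_continuous.
apply: cvgM => /=; first exact: cvg_cst.
have jlR : j%:R <= l%:R :> R by rewrite ler_nat.
have d0 : 0 < 1 + b - c - (b - s + j%:R) by lra.
have := gauss_summation hb d0; rewrite (addrC b 1).
have -> : 1 + b - (b - s + j%:R) = 1 + s - j%:R by ring.
by have -> : 1 + b - c - (b - s + j%:R) = 1 + s - j%:R - c by ring.
Qed.

(** If -a3 is a natural number m, the terms beyond m vanish through (a3)_k, so the partial sums
    stabilise at the finite sum; one limit thus serves both readings of the series. *)
Lemma hyp3F2_of_cvg (R : realType) (a1 a2 a3 b1 b2 L : R) :
  series (hyp3F2_term a1 a2 a3 b1 b2 1) @ \oo --> L ->
  hyp3F2_converges (lhs_terms a3) a1 a2 a3 b1 b2 1 /\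
  hyp3F2 (lhs_terms a3) a1 a2 a3 b1 b2 1 = L.
Proof.
move=> H; rewrite /hyp3F2_converges /hyp3F2 /lhs_terms.
case: ifPn => [/natrP[m am]|_]; last first.
  by split; [apply/cvg_ex; exists L|exact/cvg_lim].
split=> //; rewrite am natrK; apply: (cvg_unique _ _ H) => //.
apply: (@cvg_trans _ ((fun=> \sum_(k < m.+1) hyp3F2_term a1 a2 a3 b1 b2 1 k) @ \oo));
  last exact: cvg_cst.
apply: near_eq_cvg; exists m.+1 => // n /= mn.
rewrite /series /= big_mkord; symmetry; apply: sum_ord_trim => // j mj.
by rewrite /hyp3F2_term -[a3]opprK am rising_pole// !(mulr0, mul0r).
Qed.

(** Applied with z = a - b, to merge the prefactor with a Vandermonde coefficient. For n >= l the
    two products concatenate; for n < l, (z)_(n-l) is the inverse of the first l - n factors, by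
    reflection. *)
Lemma poch_mul_rising (R : realType) (z : R) n l j :
  poch_finite z (n%:Z - l%:Z) -> (j <= n)%N -> (j <= l)%N ->
  poch z (n%:Z - l%:Z) * rising (z - l%:R + n%:R) (l - j) = rising z (n - j).
Proof.
move=> zfin jn jl; have [ln|nl] := leqP l n.
  have -> : z - l%:R + n%:R = z + (n - l)%:R by rewrite natrB//; ring.
  rewrite subzn//= -risingD; congr rising; lia.
(* [Negz p] encodes -(p + 1), hence the predecessor. *)
have E : n%:Z - l%:Z = Negz (l - n).-1 by rewrite NegzE; lia.
have m1 : (l - n).-1.+1 = (l - n)%N by lia.
rewrite E /= m1 in zfin *.
have -> : (l - j = (l - n) + (n - j))%N by lia.
rewrite risingD; have -> : z - l%:R + n%:R + (l - n)%:R = z.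
  by rewrite natrB 1?ltnW//; ring.
have -> : z - l%:R + n%:R = - ((l - n)%:R - z) by rewrite natrB 1?ltnW//; ring.
rewrite rising_opp.
have -> : (l - n)%:R - z - (l - n)%:R + 1 = 1 - z by ring.
rewrite mulrA [X in X * _](_ : _ = (-1) ^+ (l - n) * (-1) ^+ (l - n)).
  by rewrite -exprMn mulrNN mul1r expr1n mul1r.
by field.
Qed.

(** The prefactor clears the denominators: (1 - b)_n splits at k, and the last k factors of (a - c -
    l)_n reflect to (1 - a + c + l - n)_k with a sign that cancels that of (-n)_k. *)
Lemma hyp3F2_reversed_sum (R : realType) (a b c : R) n l :
  (forall k, (k < n.+1)%N -> rising (1 - b) k != 0 /\
     rising (1 - a + c + l%:R - n%:R) k != 0) ->
  rising (a - c - l%:R) n * rising (1 - b) n / n`!%:R *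
  \sum_(k < n.+1) hyp3F2_term (- n%:R) (1 - a) (c - b)
        (1 - b) (1 - a + c + l%:R - n%:R) 1 k =
  \sum_(k < n.+1) rising (1 - a) k * rising (c - b) k *
     rising (a - c - l%:R) (n - k) * rising (1 - b + k%:R) (n - k) /
     (k`!%:R * (n - k)`!%:R).
Proof.
move=> H; rewrite mulr_sumr; apply: eq_bigr => -[k] /= kn _.
have [h1 h2] := H k kn; rewrite ltnS in kn.
rewrite /hyp3F2_term expr1n rising_opp_nat natrM.
have f0 i : i`!%:R != 0 :> R by rewrite gt_eqF ?natr_fact_gt0.
have E1 : rising (1 - b) n = rising (1 - b) k * rising (1 - b + k%:R) (n - k).
  by rewrite -risingD subnKC.
have E2 : rising (a - c - l%:R) n = rising (a - c - l%:R) (n - k) *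
    ((-1) ^+ k * rising (1 - a + c + l%:R - n%:R) k).
  rewrite -{1}(subnK kn) risingD; congr (_ * _).
  have -> : a - c - l%:R + (n - k)%:R = - (k%:R - n%:R - a + c + l%:R).
    by rewrite natrB//; ring.
  by rewrite rising_opp; congr (_ * rising _ _); ring.
have B := bin_invfact R n k; rewrite kn in B.
have S : (-1) ^+ k * (-1) ^+ k = 1 :> R by rewrite -exprMn mulrNN mul1r expr1n.
rewrite E1 E2 -B.
transitivity (((-1) ^+ k * (-1) ^+ k) * (rising (1 - a) k * rising (c - b) k *
  rising (a - c - l%:R) (n - k) * rising (1 - b + k%:R) (n - k) *
  ('C(n, k)%:R / n`!%:R))); last by rewrite S mul1r.
by field; rewrite !f0 h1 h2.
Qed.

Theorem theorem1 (R : realType) (l : nat) (r : int) (a b c : R)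
  (hc : c < r%:~R - l%:R \/ (- c \is a Num.nat /\ c <= r%:~R - l%:R))
  (hleft : hyp3F2_denoms_neq0 (lhs_terms c) (a - l%:R) (b + 1))
  (hright : hyp3F2_denoms_neq0 (rhs_terms r)
              (1 - b) (1 - a + c + l%:R - r%:~R))
  (hGc : ~~ Gamma_pole (1 - c))
  (hGb : ~~ Gamma_pole (1 + b))
  (hfin1 : poch_finite (a - c - l%:R) r)
  (hfin2 : poch_finite (1 - b) r)
  (hfin3 : poch_finite (a - b) (r - l%:Z))
  (hnz1 : poch (1 - a) l%:Z != 0)
  (hnz2 : poch (a - b) (r - l%:Z) != 0) :
  let lhs := hyp3F2 (lhs_terms c) a (b - r%:~R) c (a - l%:R) (b + 1) 1 in
  let rhs :=
    (-1) ^+ l * Gamma (1 - c) * Gamma (1 + b)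
    * poch (a - c - l%:R) r * poch (1 - b) r * invGamma (1 + b - c)
    / (poch (1 - a) l%:Z * poch (a - b) (r - l%:Z)) * invfact r
    * hyp3F2 (rhs_terms r) (- r%:~R) (1 - a) (c - b)
        (1 - b) (1 - a + c + l%:R - r%:~R) 1 in
  [/\ hyp3F2_converges (lhs_terms c)
        a (b - r%:~R) c (a - l%:R) (b + 1) 1,
      lhs = rhs
    & r < 0 -> lhs = 0 /\ rhs = 0].
Proof.
have hc1 : c < r%:~R + 1 - l%:R by case: hc => [|[_]] ?; lra.
have al : rising (a - l%:R) l = (-1) ^+ l * rising (1 - a) l.
  rewrite -[a - _]opprB rising_opp; congr (_ * rising _ _); ring.
have l0 : rising (a - l%:R) l != 0 by rewrite al mulf_neq0 ?signr_eq0.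
(* In the terminating case [hleft] speaks only of k <= -c; beyond that (c)_k is 0. *)
have ck k : rising (a - l%:R) k = 0 -> rising c k = 0.
  move: hleft; rewrite /hyp3F2_denoms_neq0 /lhs_terms.
  case: ifPn => [/natrP[m cm]|_] /(_ k); last by move=> /(_ isT)[/eqP].
  rewrite cm natrK; have [km|km] := ltnP k m.+1; first by move=> /(_ isT)[/eqP].
  by move=> _ _; rewrite -[c]opprK cm rising_pole.
have [cv lhsE] := hyp3F2_of_cvg (hyp3F2_cvg hc1 hGb l0 ck).
move=> lhs rhs; rewrite {}/lhs {}lhsE.
suff H : (r < 0 -> rhs = 0) /\ \sum_(j < l.+1) 'C(l, j)%:R *
    rising (b - r%:~R) j * rising (a - b - l%:R + r%:~R) (l - j) /
    rising (a - l%:R) l *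
    (invGamma (1 + b - c) * invGamma (1 + r%:~R - j%:R) /
      (invGamma (1 + b) * invGamma (1 + r%:~R - j%:R - c))) = rhs.
  by case: H => rhs0 H; split=> // r0; rewrite H rhs0.
rewrite {}/rhs; move: hc1 hright hfin3 hnz2 {hc cv hfin1 hfin2}.
case: r => [n|n] hc1 hright hfin3 hnz2; last first.
  (* Here r = -(n + 1), so 1 + r - j = -(n + j) is a pole of Gamma for every j. *)
  rewrite /= mulr0 mul0r; split=> //; apply: big1 => j _.
  rewrite (_ : invGamma (1 + _ - j%:R) = 0) ?mulr0 ?mul0r ?mulr0//.
  rewrite /invGamma /Gamma_pole ifT// NegzE mulrNz -pmulrn -natr1.
  have -> : - (1 - (n%:R + 1) - j%:R) = (n + j)%:R :> R by rewrite natrD; ring.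
  exact: natr_nat.
split=> //; rewrite -[n%:~R]/(n%:R) in hc1 hright *.
have f0 i : i`!%:R != 0 :> R by rewrite gt_eqF ?natr_fact_gt0.
rewrite !GammaE// [hyp3F2 (rhs_terms n) _ _ _ _ _ _]/=.
rewrite [poch _ n]/= [poch (1 - b) n]/= [poch _ l]/= [invfact n]/= in hnz1 hnz2 *.
set Q := poch _ _ in hnz2 *; set T := \sum_(k < n.+1) _.
have key := hyp3F2_reversed_sum hright; rewrite -/T terminating_transformation in key.
have hb0 := invGamma_neq0 hGb; have hc0 := invGamma_neq0 hGc.
(* [pre] gathers the factors independent of j; by [al] its 1 / (a - l)_l absorbs the sign (-1)^l. *)
set pre := invGamma (1 + b - c) / (invGamma (1 + b) * invGamma (1 - c)) /
   (rising (a - l%:R) l * Q).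
transitivity (pre * (rising (a - c - l%:R) n * rising (1 - b) n / n`!%:R * T)); last first.
  by rewrite /pre al !invfM invr_sign; ring.
rewrite key mulr_sumr.
pose g j : R := 'C(l, j)%:R * rising (b - n%:R) j *
    rising (a - b - l%:R + n%:R) (l - j) / rising (a - l%:R) l *
    (invGamma (1 + b - c) * invGamma (1 + n%:R - j%:R) /
      (invGamma (1 + b) * invGamma (1 + n%:R - j%:R - c))).
(* Terms with j > n vanish at a pole of Gamma and those with j > l through the binomial, so the two
   ranges give the same sum. *)
rewrite (@sum_ord_support _ g l.+1 n.+1); first last.
- move=> j nj; rewrite /g (_ : invGamma (1 + _ - j%:R) = 0) ?mulr0 ?mul0r ?mulr0//.
  rewrite /invGamma /Gamma_pole ifT//.
  have -> : - (1 + n%:R - j%:R) = (j - n.+1)%:R :> R.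
    by rewrite natrB// -natr1; ring.
  exact: natr_nat.
- by move=> j lj; rewrite /g bin_small// !mul0r.
apply: eq_bigr => -[j] /=; rewrite ltnS /g => jn _.
have [lj|jl] := ltnP l j; first by rewrite bin_small// !(mul0r, mulr0).
have P := poch_mul_rising hfin3 jn jl; rewrite -/Q in P; rewrite -P.
have nj : 1 + n%:R - j%:R = (n - j).+1%:R :> R by rewrite -natr1 natrB//; ring.
have G1 := invGamma_rising (1 - c) (n - j).
have nj' : 1 - c + (n - j)%:R = 1 + n%:R - j%:R - c by rewrite natrB//; ring.
rewrite nj' in G1; rewrite nj invGamma_natS -nj.
(* By [G1] the product of these factors is 1/Gamma(1 - c), nonzero because 1 - c is not a pole. *)
have [r0 i0] : rising (1 - c) (n - j) != 0 /\ invGamma (1 + n%:R - j%:R - c) != 0.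
  by apply/andP; rewrite -negb_or -mulf_eq0 -G1.
rewrite /pre G1; field.
by rewrite f0 r0 i0 hb0 hnz2 l0.
Qed.
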